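(* Consider any instance of online bipartite matching with (possibly heterogeneous and overlapping) protected groups under the long-run fairness objective, and let $\lambda=\min_{j\in J}\lambda_j$. Then the competitiveness of the algorithm RESERVE is at least $\frac{\mathbb E[\min\{\mathrm{Pois}(\lambda),\lambda\}]}{\lambda}$, which equals $1-e^{-\lambda}\frac{\lambda^\lambda}{\lambda!}$ when $\lambda$ is an integer; this bound approaches $1$ as $\lambda\to\infty$.
   Context: Model: $I$ finite set of offline agents, $J$ finite set of online types, $E\subseteq I\times J$ eligible pairs; $\mathcal N_i=\{j:(i,j)\in E\}$, $\mathcal N_j=\{i:(i,j)\in E\}$. Offline agent $i$ has integer capacity $b_i\ge1$. Online agents of type $j$ arrive by independent Poisson processes of constant rate $\lambda_j>0$ on $[0,1]$; on arrival the type is revealed and an online algorithm must immediately and irrevocably serve it with some $i\in\mathcal N_j$ with remaining capacity, or reject it. A clairvoyant algorithm knows the realized arrivals in advance and assigns (possibly randomly) subject to the same constraints. Protected groups: a family $\mathcal G$ of subsets of $J$ covering $J$. With $X(G)$ the number of served agents whose type lies in $G$, the long-run fairness is $\min_{G\in\mathcal G}\mathbb E[X(G)]/\sum_{j\in G}\lambda_j$. Competitiveness is the ratio of the algorithm's objective to the optimal clairvoyant objective. $\mathrm{Pois}(\mu)$ denotes a Poisson random variable with mean $\mu$. Generalized LP: maximize $s$ subject to $\sum_{j\in\mathcal N_i}x_{ij}\le b_i$ for all $i$; $\sum_{j\in G}\sum_{i\in\mathcal N_j}x_{ij}\ge s\sum_{j\in G}\lambda_j$ for all $G\in\mathcal G$;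 $\sum_{i\in\mathcal N_j}x_{ij}\le\lambda_j$ for all $j$; $s,x_{ij}\ge0$. Algorithm RESERVE: first replace each offline agent $i$ by $b_i$ unit-capacity copies with the same eligible types. Solve the generalized LP for the resulting instance to get $x^*$ and set $x^*_j=\sum_{i\in\mathcal N_j}x^*_{ij}\le\lambda_j$. Then randomly round to binary $X^R_{ij}$ with $\sum_{j}X^R_{ij}\le1$ for each (unit) offline agent $i$, such that the sets $\mathrm{serve}(j)=\{i:X^R_{ij}=1\}$ are pairwise disjoint, $|\mathrm{serve}(j)|\in\{\lfloor x^*_j\rfloor,\lceil x^*_j\rceil\}$ and $\mathbb E|\mathrm{serve}(j)|=x^*_j$ for every $j$ (such a rounding exists, e.g. by dependent rounding). Each set $\mathrm{serve}(j)$ is reserved exclusively for type $j$: arriving type-$j$ agents are served first-come-first-serve by the unused agents in $\mathrm{serve}(j)$ and rejected once these are exhausted. *)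

(* Defs.v *)
From mathcomp Require Import all_boot all_order all_algebra.
From mathcomp Require Import all_classical all_reals all_analysis.

Set Implicit Arguments.
Unset Strict Implicit.
Unset Printing Implicit Defensive.
Import Order.TTheory GRing.Theory Num.Theory.
Import numFieldNormedType.Exports.
Local Open Scope classical_set_scope.
Local Open Scope ring_scope.

(* [I] is the set of offline agents, [J] the set of online types.  The groups
   are nonempty because the fairness objective divides by their total rate. *)
Record instance (R : realType) (I J : finType) := Instance {
  elig : I -> J -> bool;
  cap : I -> nat;
  rate : J -> R;
  groups : {set {set J}};
  cap_gt0 : forall i, (0 < cap i)%N;
  rate_gt0 : forall j, 0 < rate j;
  groups_cover : finset.cover groups = finset.setT;
  groups_neq0 : finset.set0 \notin groups }.

Definition is_min_rate (R : realType) (I J : finType) (inst : instance R I J)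
    (lam : R) : Prop :=
  (exists j, rate inst j = lam) /\ (forall j, lam <= rate inst j).

Section Arrivals.
Context (R : realType) (J : finType) (d : measure_display)
  (T : measurableType d).

(* An outcome [w] yields the finite list [A w] of (arrival time, type) pairs
   of the online agents, in order of arrival. *)
Implicit Types (A : T -> seq (R * J)) (P : probability T R).

Definition num_arrivals A (j : J) (s t : R) (w : T) : nat :=
  count (fun a : R * J => (a.2 == j) && (s < a.1 <= t)) (A w).

(* Generators of the sigma-algebra of the arrivals: the [k]-th arrival exists,
   has type [j] and occurs no later than [t].  The default value of [nth] is
   never reached. *)
Definition arrival_events A : set (set T) :=
  [set S | exists k j t, S =
    [set w | [/\ (k < size (A w))%N, (nth (0, j) (A w) k).2 = j
                & (nth (0, j) (A w) k).1 <= t]]].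

(* Independent Poisson processes on [0, 1], one per type: times are listed in
   nondecreasing order, there is no arrival at time 0, increments over ]s, t]
   are Poisson, and the increments over successive intervals and over all types
   are mutually independent (product rule over all tuples of values). *)
Record poisson_arrivals (lam : J -> R) P A : Prop := PoissonArrivals {
  arrivals_measurable : arrival_events A `<=` measurable;
  arrivals_sorted : forall w, sorted (fun a b : R * J => a.1 <= b.1) (A w);
  arrivals_01 : forall w, all (fun a : R * J => 0 < a.1 <= 1) (A w);
  arrivals_poisson : forall j (s t : R) (n : nat), 0 <= s -> s < t -> t <= 1 ->
    P [set w | num_arrivals A j s t w = n] =
    (poisson_pmf (lam j * (t - s)) n)%:E;
  arrivals_independent :
    forall (n : nat) (t : nat -> R) (m : J -> 'I_n -> nat),
    0 <= t 0%N -> (forall k, (k < n)%N -> t k < t k.+1) -> t n <= 1 ->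
    P [set w | forall (j : J) (k : 'I_n),
                 num_arrivals A j (t k) (t k.+1) w = m j k] =
    (\prod_(j : J) \prod_(k < n)
       P [set w | num_arrivals A j (t k) (t k.+1) w = m j k])%E }.

End Arrivals.

(* A decision list [dec] is parallel to the arrival list [arr]: [Some i] serves
   the corresponding online agent with [i], [None] rejects it. *)
Definition num_served (R : realType) (I J : finType) (G : {set J})
    (arr : seq (R * J)) (dec : seq (option I)) : nat :=
  count (fun p : (R * J) * option I => (p.1.2 \in G) && isSome p.2)
        (zip arr dec).

Definition assignment (R : realType) (I J : finType) (inst : instance R I J)
    (arr : seq (R * J)) (dec : seq (option I)) : Prop :=
  [/\ size dec = size arr,
      all (fun p : (R * J) * option I =>
             if p.2 is Some i then elig inst i p.1.2 else true) (zip arr dec)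
    & forall i, (count_mem (Some i) dec <= cap inst i)%N].

(* The type [K] of servers may differ from [I]: it is the type of unit-capacity
   copies when RESERVE is evaluated. *)
Definition fairness (R : realType) (I J : finType) (inst : instance R I J)
    (d : measure_display) (T : measurableType d) (P : probability T R)
    (K : finType) (A : T -> seq (R * J)) (D : T -> seq (option K)) : \bar R :=
  (\big[Order.min/+oo]_(G in groups inst)
     ('E_P[fun w => (num_served G (A w) (D w))%:R]
      / (\sum_(j in G) rate inst j)%:E))%E.

(* The decisions [D w] may depend on the whole outcome [w], hence on all
   arrivals and on extra randomness carried by the probability space. *)
Record clairvoyant (R : realType) (I J : finType) (inst : instance R I J)
    (d : measure_display) (T : measurableType d)
    (A : T -> seq (R * J)) (D : T -> seq (option I)) : Prop := Clairvoyant {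
  clairvoyant_assignment : forall w, assignment inst (A w) (D w);
  clairvoyant_measurable : forall (k : nat) (i : I),
    measurable [set w | nth None (D w) k = Some i] }.

Definition clairvoyant_opt (R : realType) (I J : finType)
    (inst : instance R I J) : \bar R :=
  ereal_sup [set v | exists (d : measure_display) (T : measurableType d)
      (P : probability T R) (A : T -> seq (R * J)) (D : T -> seq (option I)),
    [/\ poisson_arrivals (rate inst) P A, clairvoyant inst A D
      & v = fairness inst P A D]].

Definition lp_feasible (R : realType) (I J : finType) (inst : instance R I J)
    (x : I -> J -> R) (s : R) : Prop :=
  [/\ forall i, \sum_(j | elig inst i j) x i j <= (cap inst i)%:R,
      forall G, G \in groups inst ->
        s * (\sum_(j in G) rate inst j)
          <= \sum_(j in G) \sum_(i | elig inst i j) x i j,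
      forall j, \sum_(i | elig inst i j) x i j <= rate inst j,
      0 <= s
    & forall i j, elig inst i j -> 0 <= x i j].

Definition lp_optimal (R : realType) (I J : finType) (inst : instance R I J)
    (x : I -> J -> R) (s : R) : Prop :=
  lp_feasible inst x s /\
  forall x' s', lp_feasible inst x' s' -> s' <= s.

Definition copies (R : realType) (I J : finType) (inst : instance R I J)
    : finType :=
  {i : I & 'I_(cap inst i)}.

Definition unit_copies (R : realType) (I J : finType) (inst : instance R I J)
    : instance R (copies inst) J :=
  @Instance R (copies inst) J
    (fun u j => elig inst (tag u) j) (fun=> 1%N) (rate inst) (groups inst)
    (fun=> isT) (@rate_gt0 _ _ _ inst) (@groups_cover _ _ _ inst)
    (@groups_neq0 _ _ _ inst).

Section Reserve.
Context (R : realType) (U J : finType) (inst : instance R U J)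
  (d : measure_display) (T : measurableType d) (P : probability T R).

Definition lp_served (x : U -> J -> R) (j : J) : R :=
  \sum_(u | elig inst u j) x u j.

Definition serve_set (X : {ffun U * J -> bool}) (j : J) : {set U} :=
  finset.finset (fun u => X (u, j)).

(* Pairwise disjointness of the sets [serve_set (XR w) j] is the second
   condition. *)
Record rounding (x : U -> J -> R) (XR : T -> {ffun U * J -> bool}) : Prop :=
  Rounding {
  rounding_elig : forall w u j, XR w (u, j) -> elig inst u j;
  rounding_le1 : forall w u, (\sum_j XR w (u, j) <= 1)%N;
  rounding_floor_ceil : forall w j,
    #|serve_set (XR w) j|%:Z = Num.floor (lp_served x j) \/
    #|serve_set (XR w) j|%:Z = Num.ceil (lp_served x j);
  rounding_measurable : forall X, measurable [set w | XR w = X];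
  rounding_mean : forall j,
    ('E_P[fun w => #|serve_set (XR w) j|%:R] = (lp_served x j)%:E)%E }.

Definition independent_of_arrivals (A : T -> seq (R * J))
    (XR : T -> {ffun U * J -> bool}) : Prop :=
  forall X S, <<s arrival_events A >> S ->
    P ([set w | XR w = X] `&` S) = (P [set w | XR w = X] * P S)%E.

(* Processing of the arrivals when the agents in [used] are already matched: an
   arriving agent of type [j] is served by some unused agent of [serve j], the
   choice being free, and is rejected exactly when there is none. *)
Fixpoint reserve_run (serve : J -> {set U}) (used : {set U})
    (arr : seq (R * J)) (dec : seq (option U)) : bool :=
  match arr, dec with
  | [::], [::] => true
  | a :: arr', Some u :: dec' =>
      [&& u \in serve a.2, u \notin used
        & reserve_run serve (finset.setU [set u]%SET used) arr' dec']
  | a :: arr', None :: dec' =>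
      (serve a.2 \subset used) && reserve_run serve used arr' dec'
  | _, _ => false
  end.

End Reserve.

(* One execution of RESERVE on [inst]: LP solution [x], rounding [XR] and
   decisions [D], all over the unit-capacity copies of the offline agents. *)
Record reserve (R : realType) (I J : finType) (inst : instance R I J)
    (d : measure_display) (T : measurableType d) (P : probability T R)
    (A : T -> seq (R * J)) (x : copies inst -> J -> R)
    (XR : T -> {ffun copies inst * J -> bool})
    (D : T -> seq (option (copies inst))) : Prop := Reserve {
  reserve_lp : exists s, lp_optimal (unit_copies inst) x s;
  reserve_rounding : rounding (unit_copies inst) P x XR;
  reserve_indep : independent_of_arrivals P A XR;
  reserve_fcfs : forall w,
    reserve_run (serve_set (XR w)) finset.set0 (A w) (D w) }.
Arguments reserve [R I J] inst [d T] P A x XR D.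

(* [alg] is at least the fraction [c] of [opt]; the product form of the ratio
   avoids 0 / 0 when [opt] is 0. *)
Definition competitive (R : realType) (c alg opt : \bar R) : Prop :=
  (c * opt <= alg)%E.

(* [E[min(Pois(lam), lam)] / lam].  The last argument of [poisson_prob] is a
   dummy: the library definition does not depend on it. *)
Definition reserve_bound (R : realType) (lam : R) : \bar R :=
  ('E_(poisson_prob lam 0%N)[fun k : nat => Num.min k%:R lam] / lam%:E)%E.

(* Main.v *)
Require Import Defs.
From mathcomp Require Import all_boot all_order all_algebra.
From mathcomp Require Import all_classical all_reals all_analysis.
From mathcomp Require Import measurable_realfun ring lra.
Import Order.TTheory GRing.Theory Num.Theory.
Import numFieldNormedType.Exports.
Local Open Scope classical_set_scope.
Local Open Scope ring_scope.

(* The mean assignments of a clairvoyant algorithm are feasible for the LP, and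
   splitting them evenly over the copies of each agent bounds the clairvoyant
   optimum by the LP value of the unit-copies instance.  Conversely RESERVE
   serves exactly min(N_j, |serve j|) agents of type j; as |serve j| is
   independent of N_j and rounds x_j to a neighbouring integer, the mean of this
   is E[min(N_j, x_j)] >= x_j / rate_j * E[min(N_j, rate_j)].  Finally
   E[(rate - N)^+] telescopes to rate * p, with p the Poisson pmf at
   floor(rate), so that E[min(N, rate)] / rate = 1 - p.  The mode probability p
   decreases in rate, because 1 + t <= exp t, and tends to 0, because by
   Bernoulli's inequality about sqrt(rate) neighbouring values are at least half
   as likely as the mode. *)

Set Implicit Arguments.
Unset Strict Implicit.
Unset Printing Implicit Defensive.

(** * Poisson probabilities *)

Lemma poisson_pmfS (R : realType) (lam : R) (k : nat) : 0 < lam ->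
  k.+1%:R * poisson_pmf lam k.+1 = lam * poisson_pmf lam k.
Proof.
move=> lam0; rewrite /poisson_pmf lam0 exprS factS natrM.
by field; rewrite nat1r !pnatr_eq0 -lt0n fact_gt0.
Qed.

(** By [poisson_pmfS] the term at [k > 0] is [lam] times the difference of the probabilities of [k]
    and [k - 1], so the sum telescopes. *)
Lemma sum_poisson_deficit (R : realType) (lam : R) (m : nat) : 0 < lam ->
  \sum_(k < m.+1) (lam - k%:R) * poisson_pmf lam k = lam * poisson_pmf lam m.
Proof.
move=> lam0; elim: m => [|m IH]; first by rewrite big_ord1 subr0.
by rewrite big_ord_recr /= IH mulrBl poisson_pmfS // addrC subrK.
Qed.

(** The probability of the mode of the Poisson law, which is the fraction lost by RESERVE. *)
Definition poisson_peak (R : realType) (lam : R) : R :=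
  poisson_pmf lam (Num.truncn lam).

(** Write [min(n, lam)] as [lam] minus the positive part of [lam - n]; the latter vanishes beyond
    the floor of [lam], and [sum_poisson_deficit] sums the rest. The weights [q] stand for the law
    of a Poisson variable truncated at [M], so [q M] carries the whole tail. *)
Lemma sum_poisson_min (R : realType) (lam : R) (M : nat) (q : nat -> R) :
  0 < lam -> lam <= M%:R -> \sum_(n < M.+1) q n = 1 ->
  (forall n, (n < M)%N -> q n = poisson_pmf lam n) ->
  \sum_(n < M.+1) Num.min n%:R lam * q n = lam * (1 - poisson_peak lam).
Proof.
move=> lam0 lamM q1 qpmf; set m := Num.truncn lam.
have /andP[mlam lamm] := truncn_itv (ltW lam0).
have mM : (m <= M)%N by rewrite -(ler_nat R) (le_trans _ lamM).
have -> : \sum_(n < M.+1) Num.min n%:R lam * q n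
    = lam * \sum_(n < M.+1) q n
      - \sum_(n < M.+1) Num.max (lam - n%:R) 0 * q n.
  rewrite mulr_sumr -sumrB; apply: eq_bigr => n _; rewrite -mulrBl.
  congr (_ * _); rewrite /Num.min /Num.max subr_lt0.
  by case: ltgtP => [||->]; rewrite ?subr0 //; lra.
rewrite q1 mulr1 mulrBr mulr1; congr (_ - _).
rewrite -(sum_poisson_deficit m lam0).
have zero n : (m < n)%N -> Num.max (lam - n%:R) 0 = 0.
  move=> mn; apply/max_idPr; rewrite subr_le0 (le_trans (ltW lamm)) //.
  by rewrite ler_nat.
rewrite -(big_mkord xpredT (fun n => Num.max (lam - n%:R) 0 * q n)).
rewrite -(big_mkord xpredT (fun n => (lam - n%:R) * poisson_pmf lam n)).
(* The value [q M] is not given by the Poisson pmf. If [m = M], then [lam = m] and the terms at [M]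
   vanish on both sides; otherwise [M] lies beyond [m]. *)
move: mM; rewrite leq_eqVlt => /orP[/eqP mM|mM].
  rewrite -mM big_nat_recr //= [RHS]big_nat_recr //=.
  have ml : lam = m%:R.
    by apply/eqP; rewrite eq_le mlam mM lamM.
  rewrite -ml subrr maxxx !mul0r; congr (_ + _).
  apply: eq_big_nat => n /andP[_ nm]; rewrite qpmf; last by rewrite -mM.
  congr (_ * _); apply/max_idPl; rewrite subr_ge0 (le_trans _ mlam) //.
  by rewrite ler_nat ltnW.
rewrite (@big_cat_nat _ _ _ m.+1) //=; last by rewrite ltnS ltnW.
rewrite [X in _ + X]big_nat_cond [X in _ + X]big1 ?addr0; last first.
  by move=> n /andP[/andP[mn _] _]; rewrite zero ?mul0r.
apply: eq_big_nat => n /andP[_ nm]; rewrite qpmf ?(leq_ltn_trans _ mM) //.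
congr (_ * _); apply/max_idPl; rewrite subr_ge0 (le_trans _ mlam) //.
by rewrite ler_nat.
Qed.

(** The ratio of the two sides is [(mu / lam)^m * exp(lam - mu)]. It is at most 1 because
    [mu / lam <= exp((mu - lam) / lam)] and [m / lam <= 1]. *)
Lemma poisson_pmf_anti (R : realType) (lam mu : R) (m : nat) :
  0 < lam -> lam <= mu -> m%:R <= lam -> poisson_pmf mu m <= poisson_pmf lam m.
Proof.
move=> lam0 lamu mlam; have mu0 := lt_le_trans lam0 lamu.
rewrite /poisson_pmf lam0 mu0 -!mulrA [X in X <= _]mulrCA [X in _ <= X]mulrCA.
rewrite ler_pM2l ?invr_gt0 ?ltr0n ?fact_gt0 //.
have -> : mu ^+ m * expR (- mu) =
    lam ^+ m * expR (- lam) * ((mu / lam) ^+ m * expR (lam - mu)).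
  rewrite mulrACA -exprMn -expRD mulrCA divff ?gt_eqF // mulr1.
  by congr (_ * expR _); lra.
apply: ler_piMr; first by rewrite mulr_ge0 ?exprn_ge0 ?expR_ge0 // ltW.
have h : mu / lam <= expR ((mu - lam) / lam).
  by apply: le_trans (expR_ge1Dx _); rewrite mulrBl divff ?gt_eqF // addrC subrK.
apply: (@le_trans _ _ (expR ((mu - lam) / lam) ^+ m * expR (lam - mu))).
  rewrite ler_wpM2r ?expR_ge0 // lerXn2r ?nnegrE ?expR_ge0 //.
  by rewrite divr_ge0 // ltW.
rewrite -expRM_natl -expRD -[leRHS]expR0 ler_expR.
have : m%:R / lam <= 1 by rewrite ler_pdivrMr // mul1r.
move=> h1; have : m%:R / lam * (mu - lam) <= 1 * (mu - lam).
  by rewrite ler_wpM2r // subr_ge0.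
rewrite mulrA mulrAC; lra.
Qed.

(** At an integer rate the mode is attained twice. This is where the floor in [poisson_peak] can
    jump without a change of the probability. *)
Lemma poisson_pmf_diag (R : realType) (m : nat) :
  poisson_pmf (m.+1%:R : R) m.+1 = poisson_pmf m.+1%:R m.
Proof.
have m0 : (0 : R) < m.+1%:R by rewrite ltr0n.
apply: (mulfI (lt0r_neq0 m0)); exact: poisson_pmfS.
Qed.

(** Lower the rate from [mu] to the integer [m + k], drop the index by one for free with
    [poisson_pmf_diag], and repeat until the index is [m]. The bound [lam <= m.+1%:R] keeps the
    intermediate integer rates above [lam]. *)
Lemma poisson_pmf_anti_shift (R : realType) (lam : R) (m k : nat) : 0 < lam ->
  m%:R <= lam -> lam <= m.+1%:R ->
  forall mu, lam <= mu -> (m + k)%:R <= mu ->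
  poisson_pmf mu (m + k) <= poisson_pmf lam m.
Proof.
move=> lam0 mlam lamm; elim: k => [|k IH] mu lamu mkmu.
  by rewrite addn0; exact: poisson_pmf_anti.
rewrite addnS in mkmu *.
apply: (@le_trans _ _ (poisson_pmf (m + k).+1%:R (m + k).+1)).
  by apply: poisson_pmf_anti; rewrite ?ltr0n.
rewrite poisson_pmf_diag; apply: IH; last by rewrite ler_nat.
by apply: le_trans lamm _; rewrite ler_nat ltnS leq_addr.
Qed.

Lemma poisson_peak_anti (R : realType) (lam mu : R) :
  0 < lam -> lam <= mu -> poisson_peak mu <= poisson_peak lam.
Proof.
move=> lam0 lamu; have mu0 := lt_le_trans lam0 lamu.
have /andP[l1 l2] := truncn_itv (ltW lam0).
have /andP[u1 u2] := truncn_itv (ltW mu0).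
rewrite /poisson_peak -(subnKC (le_truncn lamu)).
by apply: poisson_pmf_anti_shift; rewrite ?(ltW l2) // subnKC // le_truncn.
Qed.

Lemma poisson_peak_ge0 (R : realType) (lam : R) : 0 <= poisson_peak lam.
Proof. exact: poisson_pmf_ge0. Qed.

Lemma sum_poisson_pmf_le1 (R : realType) (lam : R) (n : nat) : 0 < lam ->
  \sum_(k < n) poisson_pmf lam k <= 1.
Proof.
move=> lam0; rewrite -lee_fin -(@probability_setT _ _ R (poisson_prob lam 0%N)).
rewrite /= /poisson_prob lam0 -nneseries_esumT; last first.
  by move=> k; rewrite lee_fin poisson_pmf_ge0.
rewrite -sumEFin -(big_mkord xpredT (fun k => (poisson_pmf lam k)%:E)).
by apply: nneseries_lim_ge => k _ _; rewrite lee_fin poisson_pmf_ge0.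
Qed.

(** Moving from [n - l] to [n - l - 1] multiplies the probability by [1 - l / n], which is at least
    [1 - K / n] for [l <= K]. Bernoulli's inequality bounds the product of [i] such factors. *)
Lemma poisson_pmf_near_peak (R : realType) (n K i : nat) :
  (0 < n)%N -> (K <= n)%N -> (i <= K)%N ->
  (1 - i%:R * (K%:R / n%:R)) * poisson_pmf (n%:R : R) n
    <= poisson_pmf (n%:R : R) (n - i).
Proof.
move=> n0 Kn; have n0' : (0 : R) < n%:R by rewrite ltr0n.
elim: i => [|i IH] iK; first by rewrite subn0 mul0r subr0 mul1r.
have {}IH := IH (ltnW iK).
have iN : (n - i = (n - i.+1).+1)%N by rewrite subnSK // (leq_trans iK).
have E : poisson_pmf (n%:R : R) (n - i.+1) =
    (1 - i%:R / n%:R) * poisson_pmf (n%:R : R) (n - i).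
  apply: (mulfI (lt0r_neq0 n0')); rewrite -poisson_pmfS // -iN mulrA.
  rewrite natrB; last by rewrite (leq_trans _ Kn) // ltnW.
  by congr (_ * _); field; rewrite lt0r_neq0.
rewrite E.
have iK' : (i%:R : R) / n%:R <= K%:R / n%:R.
  by rewrite ler_pM2r ?invr_gt0 // ler_nat ltnW.
have p0 := poisson_pmf_ge0 (n%:R : R) n.
have a1 : 0 <= 1 - i%:R / (n%:R : R).
  by rewrite subr_ge0 ler_pdivrMr // mul1r ler_nat (leq_trans _ Kn) // ltnW.
apply: le_trans (ler_wpM2l a1 IH); rewrite [leRHS]mulrA ler_wpM2r //.
have aux (c a b : R) : 0 <= c -> 0 <= b -> b <= a ->
    1 - (c + 1) * a <= (1 - b) * (1 - c * a).
  move=> c0 b0 ba; have := mulr_ge0 (mulr_ge0 c0 (le_trans b0 ba)) b0; lra.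
by rewrite -natr1; apply: aux.
Qed.

Lemma poisson_peak_lt (R : realType) (e : R) : 0 < e ->
  exists2 n : nat, (0 < n)%N & poisson_peak (n%:R : R) < e.
Proof.
move=> e0; have [K Ke] : exists K : nat, 2 / e < K.+1%:R.
  by exists (Num.truncn (2 / e)); exact: truncnS_gt.
(* With [n = 2 * L^2], [i * (L / n) <= 1/2] for all [i < L], so the [L] values [n - i] each have at
   least half the probability [p] of the mode. Their total is at most 1, whence [p <= 2 / L < e]. *)
pose L := K.+1; pose n := (2 * (L * L))%N; exists n => //.
rewrite /poisson_peak natrK.
have n0 : (0 < n)%N by [].
have n0' : (0 : R) < n%:R by rewrite ltr0n.
have Ln : (L <= n)%N by rewrite /n mulnA leq_pmull.
set p := poisson_pmf _ _.
have half i : (i < L)%N -> p / 2 <= poisson_pmf (n%:R : R) (n - i).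
  move=> iL; have := @poisson_pmf_near_peak R n L i n0 Ln (ltnW iL).
  apply: le_trans; rewrite mulrC ler_wpM2r ?poisson_pmf_ge0 //.
  have : i%:R * (L%:R / n%:R) <= 2^-1 :> R.
    rewrite mulrA ler_pdivrMr // -natrM mulrC ler_pdivlMr // -natrM ler_nat.
    by rewrite mulnC /n leq_mul2l /= leq_mul2r ltnW.
  lra.
have : L%:R * (p / 2) <= 1.
  apply: le_trans (sum_poisson_pmf_le1 n.+1 n0').
  rewrite (reindex_inj rev_ord_inj) /= -(big_mkord xpredT
     (fun i => poisson_pmf n%:R (n.+1 - i.+1))).
  rewrite (@big_cat_nat _ _ _ L) //=; last by rewrite leqW.
  rewrite -[leLHS]addr0 lerD //; last first.
    by apply: sumr_ge0 => i _; exact: poisson_pmf_ge0.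
  rewrite mulr_natl -[X in _ *+ X]card_ord -sumr_const big_mkord.
  by apply: ler_sum => i _; rewrite subSS half.
have L0 : (0 : R) < L%:R by rewrite ltr0n.
move=> h; have : p <= 2 / L%:R by rewrite ler_pdivlMr //; lra.
move/le_lt_trans; apply.
by rewrite ltr_pdivrMr // mulrC -ltr_pdivrMr.
Qed.

(** * Expectations of counts with a Poisson law *)

Lemma expectation_finite_range (R : realType) (d : measure_display)
    (T : measurableType d) (P : probability T R) (K : finType) (Z : T -> K)
    (f : K -> R) :
  (forall k, measurable [set w | Z w = k]) -> (forall k, 0 <= f k) ->
  ('E_P[fun w => f (Z w)] = (\sum_k f k * fine (P [set w | Z w = k]))%:E)%E.
Proof.
move=> mZ f0; rewrite unlock.
have -> : (fun w => (f (Z w))%:E) =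
    (fun w => (\sum_k (f k)%:E * (\1_[set w | Z w = k] w)%:E)%E).
  apply/funext => w; rewrite (bigD1 (Z w)) //= indicE mem_set // mule1.
  rewrite big1 ?adde0 // => k kZ; rewrite indicE memNset ?mule0 //= => h.
  by rewrite h eqxx in kZ.
have m1 k : measurable_fun setT (EFin \o (\1_[set w | Z w = k] : T -> R)).
  by apply/measurable_EFinP; exact: measurable_indic.
rewrite ge0_integral_sum //; last 2 first.
- by move=> k; apply: measurable_funeM; exact: m1.
- by move=> k w _; rewrite mule_ge0 // lee_fin.
rewrite -sumEFin; apply: eq_bigr => k _.
rewrite ge0_integralZl ?lee_fin //; last exact: m1.
rewrite integral_indic // setIT EFinM fineK //.
exact: fin_num_measure.
Qed.

Lemma measurable_preimage_countable (d : measure_display)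
    (T : measurableType d) (N : T -> nat) :
  (forall n, measurable [set w | N w = n]) ->
  forall Y : set nat, measurable (N @^-1` Y).
Proof.
move=> mN Y; have -> : N @^-1` Y = \bigcup_(n in Y) [set w | N w = n].
  by apply/seteqP; split => [w /= Yw|w [n Yn] /= ->] //; exists (N w).
exact: bigcup_measurable.
Qed.

Lemma measurable_fun_countable (R : realType) (d : measure_display)
    (T : measurableType d) (N : T -> nat) :
  (forall n, measurable [set w | N w = n]) ->
  measurable_fun setT (fun w => ((N w)%:R : R)%:E).
Proof.
move=> mN _ Y mY; rewrite setTI.
exact: (measurable_preimage_countable mN (fun n => Y (n%:R : R)%:E)).
Qed.

(** A truncated count becomes a variable with values in a finite type, as [expectation_finite_range]
    requires; [inord] never falls back on its default. *)
Lemma fiber_inord_minn (T : Type) (N : T -> nat) (M : nat) (k : 'I_M.+1) :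
  [set w | inord (minn (N w) M) = k] = [set w | minn (N w) M = k].
Proof.
apply/seteqP; split => w /= => [<-|h]; first by rewrite inordK // ltnS geq_minr.
by apply: val_inj; rewrite /= inordK // ltnS geq_minr.
Qed.

Definition poisson_law (R : realType) (d : measure_display)
    (T : measurableType d) (P : probability T R) (lam : R) (N : T -> nat) :=
  forall n, measurable [set w | N w = n] /\
            P [set w | N w = n] = (poisson_pmf lam n)%:E.

(** Truncation at [M] makes the range finite, and leaves [min(N, lam)] unchanged as soon as
    [lam <= M]. *)
Definition trunc_pmf (R : realType) (d : measure_display)
    (T : measurableType d) (P : probability T R) (N : T -> nat) (M n : nat) :=
  fine (P [set w | minn (N w) M = n]).

Section PoissonLaw.
Context (R : realType) (d : measure_display) (T : measurableType d)
  (P : probability T R) (lam : R) (N : T -> nat).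
Hypotheses (lam0 : 0 < lam) (lawN : poisson_law P lam N).

Lemma sum_trunc_pmf M : \sum_(n < M.+1) trunc_pmf P N M n = 1.
Proof.
pose Z w : 'I_M.+1 := inord (minn (N w) M).
have ZE k : [set w | Z w = k] = [set w | minn (N w) M = k].
  exact: fiber_inord_minn.
apply: EFin_inj; rewrite -[RHS](expectation_cst P 1).
rewrite (@expectation_finite_range _ _ _ P _ Z (fun=> 1)) //.
  by congr (_%:E); apply: eq_bigr => k _; rewrite mul1r ZE.
move=> k; rewrite ZE.
have mN n : measurable [set w | N w = n] by case: (lawN n).
exact: (measurable_preimage_countable mN (fun n => minn n M = k)).
Qed.

Lemma trunc_pmfE M n : (n < M)%N -> trunc_pmf P N M n = poisson_pmf lam n.
Proof.
move=> nM; have [_ lawn] := lawN n; rewrite -[RHS]/(fine (_%:E)) -lawn /trunc_pmf.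
congr (fine (P _)); apply/seteqP; split => w /= h.
  by move: h nM; rewrite /minn; case: ltnP => // _ ->; rewrite ltnn.
by rewrite h; apply/minn_idPl/ltnW.
Qed.

Lemma sum_trunc_pmf_min M : lam <= M%:R ->
  \sum_(n < M.+1) Num.min n%:R lam * trunc_pmf P N M n
    = lam * (1 - poisson_peak lam).
Proof.
move=> lamM; apply: sum_poisson_min => //; first exact: sum_trunc_pmf.
by move=> n; exact: trunc_pmfE.
Qed.

(** Split the integral over the fibres of [N]. By [poisson_pmfS] its partial sums are [lam] times
    partial sums of the pmf, hence at most [lam]. *)
Lemma poisson_law_integral : (\int[P]_w ((N w)%:R : R)%:E <= lam%:E)%E.
Proof.
have mN n : measurable [set w | N w = n] by case: (lawN n).
have -> : [set: T] = \bigcup_n [set w | N w = n].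
  by apply/seteqP; split => // w _; exists (N w).
rewrite ge0_integral_bigcup //; last 2 first.
- apply: measurable_funTS; exact: measurable_fun_countable.
- by move=> i j _ _ [w [/= <- <-]].
have E n : (\int[P]_(w in [set w | N w = n]) ((N w)%:R : R)%:E
    = (n%:R * poisson_pmf lam n)%:E)%E.
  transitivity (\int[P]_(w in [set w | N w = n]) (n%:R : R)%:E)%E.
    by apply: eq_integral => w; rewrite inE /= => ->.
  by rewrite integral_cst // EFinM; congr (_ * _)%E; have [] := lawN n.
under eq_eseriesr do rewrite E.
apply: lime_le.
  apply: is_cvg_nneseries => n _ _.
  by rewrite lee_fin mulr_ge0 // poisson_pmf_ge0.
apply: nearW => -[|n]; first by rewrite big_geq // lee_fin ltW.
rewrite sumEFin lee_fin big_nat_recl // mul0r add0r.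
under eq_bigr do rewrite poisson_pmfS //.
rewrite -mulr_sumr ler_piMr //; first exact: ltW.
by rewrite big_mkord sum_poisson_pmf_le1.
Qed.

End PoissonLaw.

Lemma poisson_prob_law (R : realType) (lam : R) : 0 < lam ->
  poisson_law (poisson_prob lam 0%N) lam id.
Proof.
move=> lam0 n; split => //; rewrite /= /poisson_prob lam0.
have -> : [set w : nat | w = n] = [set n] by [].
by rewrite esum_set1 // lee_fin poisson_pmf_ge0.
Qed.

(** Since [M >= lam], replacing [n] by [minn n M] does not change [min(n, lam)], and the expectation
    becomes the finite sum of [sum_trunc_pmf_min]. *)
Lemma reserve_boundE (R : realType) (lam : R) : 0 < lam ->
  reserve_bound lam = (1 - poisson_peak lam)%:E.
Proof.
move=> lam0; rewrite /reserve_bound; pose M := (Num.truncn lam).+1.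
have lamM : lam <= M%:R by rewrite ltW // truncnS_gt.
have law := poisson_prob_law lam0.
pose Z n : 'I_M.+1 := inord (minn n M).
have ZE k : [set n | Z n = k] = [set n | minn n M = k].
  exact: fiber_inord_minn.
rewrite [X in ('E__[X])%E](_ : _ = fun n => Num.min (Z n)%:R lam); last first.
  apply/funext => n; rewrite inordK ?ltnS ?geq_minr // /minn.
  case: ltnP => // Mn; rewrite !(min_idPr _) //.
  by rewrite (le_trans lamM) // ler_nat.
rewrite (@expectation_finite_range _ _ _ _ _ Z (fun k => Num.min k%:R lam)) //; last first.
  by move=> k; rewrite le_min ler0n ltW.
under eq_bigr do rewrite ZE.
rewrite (sum_trunc_pmf_min lam0 law lamM) inver gt_eqF // -EFinM.
by rewrite mulrAC divff ?mul1r // gt_eqF.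
Qed.

Lemma reserve_bound_nat (R : realType) (n : nat) : (0 < n)%N ->
  reserve_bound (n%:R : R) = (1 - expR (- n%:R) * (n%:R ^+ n / n`!%:R))%:E.
Proof.
move=> n0; rewrite reserve_boundE ?ltr0n // /poisson_peak natrK /poisson_pmf.
by rewrite ltr0n n0 mulrC.
Qed.

(** By [poisson_peak_anti], one integer rate with a small peak makes the peak small at all larger
    rates. *)
Lemma reserve_bound_cvg (R : realType) :
  reserve_bound lam @[lam --> +oo%R] --> (1%E : \bar R).
Proof.
have -> : (1%E : \bar R) = (1 - 0 : R)%:E by rewrite subr0.
apply: (@cvg_trans _ ((1 - poisson_peak lam : R)%:E @[lam --> +oo%R])).
  apply: near_eq_cvg; near=> lam; rewrite reserve_boundE //.
apply: cvg_EFin; first exact: nearW.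
apply: cvgB; first exact: cvg_cst.
apply/cvgrPdist_lt => e e0; have [n n0 ne] := poisson_peak_lt e0.
near=> lam; rewrite sub0r normrN ger0_norm ?poisson_peak_ge0 //.
apply: le_lt_trans ne; apply: poisson_peak_anti; first by rewrite ltr0n.
by near: lam; exact: nbhs_pinfty_ge.
Unshelve. all: by end_near. Qed.

(** * Counting served agents and arrivals *)

Section Counting.
Context (R : realType) (I J : finType).
Implicit Types (arr : seq (R * J)) (dec : seq (option I)) (G : {set J}).

Lemma num_served_sum G arr dec :
  num_served G arr dec = (\sum_(j in G) num_served [set j] arr dec)%N.
Proof.
rewrite /num_served; elim: (zip arr dec) => [|p s IH] /=; first by rewrite big1.
rewrite big_split /= -IH; congr (_ + _)%N.
case: (boolP (p.1.2 \in G)) => pG; last first.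
  rewrite big1 // => j jG; rewrite finset.in_set1; case: eqP => // pj.
  by rewrite pj jG in pG.
rewrite (bigD1 _ pG) /= finset.in_set1 eqxx /= big1 ?addn0 // => j /andP[_ jp].
by rewrite finset.in_set1 eq_sym (negbTE jp).
Qed.

(** Its mean under a clairvoyant algorithm is the LP variable [x i j]. *)
Definition num_served_by (i : I) (j : J) arr dec : nat :=
  count (fun p : (R * J) * option I => (p.1.2 == j) && (p.2 == Some i))
    (zip arr dec).

Lemma num_served_by_assignment (inst : instance R I J) j arr dec :
  assignment inst arr dec ->
  num_served [set j] arr dec =
    (\sum_(i | elig inst i j) num_served_by i j arr dec)%N.
Proof.
move=> [_ + _]; rewrite /num_served /num_served_by.
elim: (zip arr dec) => [|[[t j'] o] s IH] /=; first by rewrite big1.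
move=> /andP[eo es]; rewrite big_split /= -IH //; congr (_ + _)%N.
rewrite finset.in_set1; case: eqP => [<-|_] /=; last by rewrite big1.
case: o eo => [i|] eo /=; last by rewrite big1.
rewrite (bigD1 i) //= eqxx big1 // => i' /andP[_ ii'].
by rewrite (inj_eq Some_inj) eq_sym (negbTE ii').
Qed.

Lemma num_served_by_cap (inst : instance R I J) (i : I) (Q : pred J) arr dec :
  assignment inst arr dec ->
  (\sum_(j | Q j) num_served_by i j arr dec <= cap inst i)%N.
Proof.
move=> [sz _ cap_i]; apply: leq_trans (cap_i i) => {cap_i}.
rewrite /num_served_by; elim: arr dec sz => [|a arr IH] [|o dec] //=.
  by move=> _; rewrite big1.
move=> [sz]; rewrite big_split leq_add ?IH //=.
case: eqP => [_|_]; last by rewrite big1 // => j _; rewrite andbF.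
rewrite (eq_bigr (fun j => nat_of_bool (j == a.2))); last first.
  by move=> j _; rewrite andbT eq_sym.
have [Qa|Qa] := boolP (Q a.2).
  by rewrite (bigD1 a.2) //= eqxx big1 // => j /andP[_ /negbTE ->].
rewrite big1 // => j Qj; case: eqP => // ja; by rewrite -ja Qj in Qa.
Qed.

Lemma num_served_le_count j arr dec :
  (num_served [set j] arr dec <= count (fun a : R * J => a.2 == j) arr)%N.
Proof.
rewrite /num_served; elim: arr dec => [|a arr IH] [|o dec] //=.
by rewrite leq_add // finset.in_set1; case: (a.2 == j); case: o.
Qed.

Lemma reserve_run_num_served (serve : J -> {set I}) used arr dec j :
  (forall j1 j2 u, u \in serve j1 -> u \in serve j2 -> j1 = j2) ->
  reserve_run serve used arr dec ->
  num_served [set j] arr dec =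
    minn (count (fun a : R * J => a.2 == j) arr) #|serve j :\: used|.
Proof.
move=> disj; rewrite /num_served.
elim: arr used dec => [|a arr IH] used [|[u|] dec] //=.
- by rewrite min0n.
- move=> /and3P[us unu run]; rewrite (IH _ _ run) finset.in_set1 andbT.
  case: (a.2 =P j) => [aj|aj] /=.
    rewrite !add1n [in RHS](cardsD1 u) !inE unu -aj us add1n minnSS.
    by rewrite finset.setDDl [(used :|: _)%SET]finset.setUC.
  rewrite !add0n; congr (minn _ _); apply: eq_card => v.
  rewrite !inE; case: (v =P u) => // ->; rewrite unu /=.
  by case: (boolP (u \in serve j)) => // uj; case: aj; exact: disj us uj.
- move=> /andP[sub run]; rewrite (IH _ _ run) andbF add0n.
  case: (a.2 =P j) => [aj|_] //.
  have -> : (serve j :\: used)%SET = finset.set0.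
    by apply/eqP; rewrite finset.setD_eq0 -aj.
  by rewrite finset.cards0 !minn0.
Qed.

End Counting.

(** The number of summands is random. The function is the pointwise limit of sums of fixed length,
    which are eventually constant because [B k] forces [k < L w]. *)
Lemma measurable_fun_count (R : realType) (d : measure_display)
    (T : measurableType d) (L : T -> nat) (B : nat -> set T) :
  (forall k, measurable (B k)) -> (forall w k, B k w -> (k < L w)%N) ->
  measurable_fun setT
    (fun w => (\sum_(k < L w) (w \in B k : nat))%N%:R : R).
Proof.
move=> mB BL.
apply: (@measurable_fun_cvg _ _ _ _ (fun K w => \sum_(k < K) \1_(B k) w)).
  move=> K; apply: measurable_sum => k; exact: measurable_indic.
move=> w _; apply: cvg_near_cst; exists (L w) => // K /= LK.
rewrite natr_sum -!(big_mkord xpredT (fun k => \1_(B k) w)).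
rewrite (@big_cat_nat _ _ _ (L w)) //= [X in _ + X]big_nat_cond.
rewrite [X in _ + X]big1 ?addr0 // => k /andP[/andP[Lk _] _].
rewrite indicE memNset //= => /BL; by rewrite ltnNge Lk.
Qed.

Lemma measurable_fiber_natr (R : realType) (d : measure_display)
    (T : measurableType d) (N : T -> nat) :
  measurable_fun setT (fun w => (N w)%:R : R) ->
  forall n, measurable [set w | N w = n].
Proof.
move=> mN n; have -> : [set w | N w = n] =
    setT `&` (fun w => (N w)%:R : R) @^-1` [set n%:R].
  rewrite setTI; apply/seteqP; split => w /= => [->//|].
  by move/eqP; rewrite eqr_nat => /eqP.
by apply: mN => //; exact: measurable_set1.
Qed.

Section ArrivalCounts.
Context (R : realType) (J : finType) (d : measure_display)
  (T : measurableType d) (A : T -> seq (R * J)).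
Hypothesis mA : arrival_events A `<=` measurable.
Hypothesis A01 : forall w, all (fun a : R * J => 0 < a.1 <= 1) (A w).

Lemma num_arrivals01 j w :
  num_arrivals A j 0 1 w = count (fun a : R * J => a.2 == j) (A w).
Proof. by apply: eq_in_count => a /(allP (A01 w)) ->; rewrite andbT. Qed.

(** The time bound 1, which always holds by [A01], makes this a generating event. The size clause
    matters because the default [(0, j)] itself has type [j]. *)
Let B j k := [set w | [/\ (k < size (A w))%N, (nth (0, j) (A w) k).2 = j
                & (nth (0, j) (A w) k).1 <= 1]].

Let mB j k : measurable (B j k).
Proof. by apply: mA; exists k, j, 1. Qed.

Let BE j k w : (k < size (A w))%N ->
  (w \in B j k) = ((nth (0, j) (A w) k).2 == j).
Proof.
move=> kA; apply/idP/idP => [|/eqP h]; first by rewrite inE => -[_ -> _].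
rewrite inE; split => //.
by have /andP[] := allP (A01 w) _ (mem_nth (0, j) kA).
Qed.

Lemma measurable_num_arrivals j n :
  measurable [set w | num_arrivals A j 0 1 w = n].
Proof.
apply: (@measurable_fiber_natr R).
rewrite [X in measurable_fun _ X](_ : _ =
    fun w => (\sum_(k < size (A w)) (w \in B j k : nat))%N%:R).
  by apply: measurable_fun_count => // w k [].
apply/funext => w; congr (_%:R); rewrite num_arrivals01.
rewrite -sum1_count (big_nth (0, j)) big_mkord big_mkcond /=.
by apply: eq_bigr => k _; rewrite BE //; case: eqP.
Qed.

Lemma measurable_num_served_by (I : finType) (D : T -> seq (option I)) i j :
  (forall w, size (D w) = size (A w)) ->
  (forall k, measurable [set w | nth None (D w) k = Some i]) ->
  measurable_fun setT (fun w => (num_served_by i j (A w) (D w))%:R : R).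
Proof.
move=> sz mD; rewrite [X in measurable_fun _ X](_ : _ =
    fun w => (\sum_(k < size (A w))
      (w \in B j k `&` [set w | nth None (D w) k = Some i] : nat))%N%:R).
  apply: (@measurable_fun_count _ _ _ _
    (fun k => B j k `&` [set w | nth None (D w) k = Some i])).
    by move=> k; exact: measurableI.
  by move=> w k [[]].
apply/funext => w; congr (_%:R); rewrite /num_served_by -sum1_count.
rewrite (big_nth ((0, j), None)) big_mkord size1_zip ?sz // big_mkcond /=.
apply: eq_bigr => k _; rewrite nth_zip //= in_setI BE //.
rewrite [X in _ = nat_of_bool (_ && X)](_ : _ = (nth None (D w) k == Some i)); last first.
  by apply/idP/eqP; rewrite inE.
by case: (_ && _).
Qed.

End ArrivalCounts.

Lemma poisson_arrivals_law (R : realType) (J : finType) (rate : J -> R)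
    (d : measure_display) (T : measurableType d) (P : probability T R)
    (A : T -> seq (R * J)) (j : J) :
  poisson_arrivals rate P A ->
  poisson_law P (rate j) (num_arrivals A j 0 1).
Proof.
move=> pA n; split.
  by apply: measurable_num_arrivals; [case: pA | case: pA].
by rewrite (arrivals_poisson pA) ?ltr01 // subr0 mulr1.
Qed.

(** * The linear program bounds the clairvoyant optimum *)

Lemma poisson_peak_le1 (R : realType) (lam : R) : 0 < lam ->
  poisson_peak lam <= 1.
Proof.
move=> lam0; apply: le_trans (sum_poisson_pmf_le1 (Num.truncn lam).+1 lam0).
by rewrite big_ord_recr /= lerDr sumr_ge0 // => k _; exact: poisson_pmf_ge0.
Qed.

Lemma measurable_sum_natr (R : realType) (d : measure_display)
    (T : measurableType d) (K : finType) (Q : pred K) (n : K -> T -> nat) :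
  (forall k, measurable_fun setT (fun w => (n k w)%:R : R)) ->
  measurable_fun setT (fun w => (\sum_(k | Q k) n k w)%N%:R : R).
Proof.
move=> mn; under eq_fun do rewrite natr_sum -big_filter.
exact: measurable_sum.
Qed.

Lemma integral_sum_natr (R : realType) (d : measure_display)
    (T : measurableType d) (P : probability T R) (K : finType) (Q : pred K)
    (n : K -> T -> nat) :
  (forall k, measurable_fun setT (fun w => (n k w)%:R : R)) ->
  (\int[P]_w ((\sum_(k | Q k) n k w)%N%:R : R)%:E =
   \sum_(k | Q k) \int[P]_w ((n k w)%:R : R)%:E)%E.
Proof.
move=> mn; under eq_integral do rewrite natr_sum -sumEFin -big_filter.
rewrite ge0_integral_sum ?big_filter //.
by move=> k; apply/measurable_EFinP.
Qed.

Lemma sum_rate_gt0 (R : realType) (I J : finType) (inst : instance R I J) G :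
  G \in groups inst -> 0 < \sum_(j in G) rate inst j.
Proof.
move=> Gg; have [G0|[j jG]] := set_0Vmem G.
  by have := groups_neq0 inst; rewrite -G0 Gg.
rewrite (bigD1 j) //= ltr_wpDr ?rate_gt0 // sumr_ge0 // => k _.
by rewrite ltW ?rate_gt0.
Qed.

(** The witnesses are the mean numbers [x i j] of type [j] agents served by [i], and the fairness
    itself for [s]; capacity and rate constraints are pathwise inequalities integrated. A group must
    exist because a minimum over no groups would be [+oo]. *)
Lemma clairvoyant_lp (R : realType) (I J : finType) (inst : instance R I J)
    (d : measure_display) (T : measurableType d) (P : probability T R)
    (A : T -> seq (R * J)) (D : T -> seq (option I)) :
  groups inst != finset.set0 -> poisson_arrivals (rate inst) P A ->
  clairvoyant inst A D ->
  exists x s, lp_feasible inst x s /\ fairness inst P A D = s%:E.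
Proof.
move=> /set0Pn[G0 G0g] pA [asg mD].
have sz w : size (D w) = size (A w) by case: (asg w).
pose n i j w := num_served_by i j (A w) (D w).
have mn i j : measurable_fun setT (fun w => (n i j w)%:R : R).
  apply: (measurable_num_served_by (arrivals_measurable pA) (arrivals_01 pA))
    => // k; exact: mD.
have mnE i j : measurable_fun setT (fun w => ((n i j w)%:R : R)%:E).
  exact/measurable_EFinP.
pose e i j := (\int[P]_w ((n i j w)%:R : R)%:E)%E.
have law j := poisson_arrivals_law j pA.
(* This serves twice: with one server [i], to make [e i j] finite, and with all servers together,
   for the rate constraint of the LP. *)
have le_rate j (K : T -> nat) :
    measurable_fun setT (fun w => (K w)%:R : R) ->
    (forall w, (K w <= num_served [set j] (A w) (D w))%N) ->
    (\int[P]_w ((K w)%:R : R)%:E <= (rate inst j)%:E)%E.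
  move=> mK KN; apply: le_trans (poisson_law_integral (rate_gt0 inst j) (law j)).
  apply: ge0_le_integral => //.
  - exact/measurable_EFinP.
  - by apply: measurable_fun_countable => m; have [] := law j m.
  - move=> w _; rewrite lee_fin ler_nat (leq_trans (KN w)) //.
    by rewrite (num_arrivals01 (arrivals_01 pA)) num_served_le_count.
have e_ge0 i j : (0 <= e i j)%E by apply: integral_ge0 => w _; rewrite lee_fin.
have e_fin i j : e i j \is a fin_num.
  rewrite ge0_fin_numE //; apply: le_lt_trans (ltry (rate inst j)).
  apply: le_rate => // w; rewrite /n /num_served_by /num_served.
  by apply: sub_count => -[[t k] o] /= /andP[/eqP -> /eqP ->]; rewrite finset.in_set1 eqxx.
pose x i j := fine (e i j).
have xE i j : (x i j)%:E = e i j by rewrite fineK.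
have served_j j w : num_served [set j] (A w) (D w)
    = (\sum_(i | elig inst i j) n i j w)%N.
  exact: num_served_by_assignment.
have ms j : measurable_fun setT
    (fun w => (num_served [set j] (A w) (D w))%:R : R).
  by under eq_fun do rewrite served_j; exact: measurable_sum_natr.
have int_j j : (\int[P]_w ((num_served [set j] (A w) (D w))%:R : R)%:E =
    (\sum_(i | elig inst i j) x i j)%:E)%E.
  under eq_integral do rewrite served_j.
  rewrite integral_sum_natr // -sumEFin; apply: eq_bigr => i _.
  by rewrite xE.
pose r (G : {set J}) := (\sum_(j in G) \sum_(i | elig inst i j) x i j)
            / \sum_(j in G) rate inst j.
have rE G : G \in groups inst ->
    ('E_P[fun w => (num_served G (A w) (D w))%:R]
      / (\sum_(j in G) rate inst j)%:E)%E = (r G)%:E.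
  move=> Gg; rewrite inver gt_eqF ?sum_rate_gt0 // EFinM; congr (_ * _)%E.
  rewrite unlock; under eq_integral do rewrite num_served_sum.
  rewrite integral_sum_natr // -sumEFin; apply: eq_bigr => j _.
  exact: int_j.
have x_ge0 i j : 0 <= x i j by rewrite -lee_fin xE.
have r_ge0 G : 0 <= r G.
  rewrite divr_ge0 ?sumr_ge0 // => j _; first by rewrite sumr_ge0.
  by rewrite ltW ?rate_gt0.
have F_ge0 : (0 <= fairness inst P A D)%E.
  by apply: le_bigmin; rewrite ?le0y // => G Gg; rewrite rE // lee_fin.
have F_le G : G \in groups inst -> (fairness inst P A D <= (r G)%:E)%E.
  by move=> Gg; rewrite -rE //; exact: bigmin_le_cond.
have F_fin : fairness inst P A D \is a fin_num.
  by rewrite ge0_fin_numE // (le_lt_trans (F_le _ G0g)) // ltry.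
exists x, (fine (fairness inst P A D)); rewrite fineK //; split => //.
split => //.
- move=> i; rewrite -lee_fin -sumEFin.
  under eq_bigr do rewrite xE.
  rewrite /e -integral_sum_natr //.
  apply: (@le_trans _ _ (\int[P]_w ((cap inst i)%:R : R)%:E)%E).
    apply: ge0_le_integral => //.
    + by apply/measurable_EFinP; exact: measurable_sum_natr.
    + by move=> w _; rewrite lee_fin ler_nat; exact: num_served_by_cap.
  by have := expectation_cst P (cap inst i)%:R; rewrite unlock => ->.
- move=> G Gg; rewrite -ler_pdivlMr ?sum_rate_gt0 // -lee_fin fineK //.
  exact: F_le.
- by move=> j; rewrite -lee_fin -int_j; exact: le_rate.
- by rewrite fine_ge0.
Qed.

Lemma sum_copies (R : realType) (I J : finType) (inst : instance R I J)
    (Q : pred I) (F : I -> R) :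
  \sum_(u : copies inst | Q (tag u)) F (tag u) / (cap inst (tag u))%:R
    = \sum_(i | Q i) F i.
Proof.
transitivity (\sum_(i | Q i) \sum_(k < cap inst i) F i / (cap inst i)%:R).
  rewrite sig_big_dep; apply: eq_bigl => u; by rewrite andbT.
apply: eq_bigr => i _; rewrite sumr_const card_ord -[(_ / _) *+ _]mulr_natr mulfVK //.
by rewrite pnatr_eq0 -lt0n cap_gt0.
Qed.

Lemma lp_feasible_unit_copies (R : realType) (I J : finType)
    (inst : instance R I J) (x : I -> J -> R) (s : R) :
  lp_feasible inst x s ->
  lp_feasible (unit_copies inst)
    (fun u j => x (tag u) j / (cap inst (tag u))%:R) s.
Proof.
move=> [xcap xG xrate s0 x0]; split => //=.
- move=> u; rewrite -mulr_suml ler_pdivrMr ?ltr0n ?cap_gt0 // mul1r.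
  exact: xcap.
- move=> G Gg; apply: le_trans (xG G Gg) _; apply: ler_sum => j _.
  by rewrite (sum_copies inst (fun i => elig inst i j) (fun i => x i j)).
- move=> j.
  by rewrite (sum_copies inst (fun i => elig inst i j) (fun i => x i j)).
- by move=> u j uj; rewrite divr_ge0 // x0.
Qed.

Lemma clairvoyant_opt_le_lp (R : realType) (I J : finType)
    (inst : instance R I J) (x : copies inst -> J -> R) (s : R) :
  groups inst != finset.set0 -> lp_optimal (unit_copies inst) x s ->
  (clairvoyant_opt inst <= s%:E)%E.
Proof.
move=> g0 [_ opt]; apply: ge_ereal_sup => _ [d [T [P [A [D [pA cD ->]]]]]].
have [y [s' [feas ->]]] := clairvoyant_lp g0 pA cD.
by rewrite lee_fin; apply: opt; exact: lp_feasible_unit_copies feas.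
Qed.

(** * Fairness of RESERVE *)

Section ReserveType.
Context (R : realType) (U J : finType) (inst : instance R U J)
  (d : measure_display) (T : measurableType d) (P : probability T R)
  (A : T -> seq (R * J)) (x : U -> J -> R)
  (XR : T -> {ffun U * J -> bool}) (D : T -> seq (option U)).
Hypotheses (pA : poisson_arrivals (rate inst) P A)
  (rnd : rounding inst P x XR) (ind : independent_of_arrivals P A XR)
  (run : forall w, reserve_run (serve_set (XR w)) finset.set0 (A w) (D w)).

Lemma serve_set_disjoint w j1 j2 u :
  u \in serve_set (XR w) j1 -> u \in serve_set (XR w) j2 -> j1 = j2.
Proof.
rewrite !inE => u1 u2; apply/eqP; apply: contraTT (rounding_le1 rnd w u).
move=> j12; rewrite (bigD1 j1) //= (bigD1 j2) /=; last by rewrite eq_sym.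
by rewrite u1 u2.
Qed.

Lemma reserve_num_served w j :
  num_served [set j] (A w) (D w) =
    minn (num_arrivals A j 0 1 w) #|serve_set (XR w) j|.
Proof.
rewrite (reserve_run_num_served _ (@serve_set_disjoint w) (run w)).
by rewrite finset.setD0 (num_arrivals01 (arrivals_01 pA)).
Qed.

(** The decisions [D] carry no measurability of their own. The count inherits it from the arrival
    count and the rounding, of which it is a function by [reserve_num_served]. *)
Lemma measurable_reserve_num_served j :
  measurable_fun setT (fun w => (num_served [set j] (A w) (D w))%:R : R).
Proof.
apply/measurable_EFinP; apply: measurable_fun_countable => n.
rewrite (_ : [set w | _] = \bigcup_(X in setT) ([set w | XR w = X] `&`
    [set w | minn (num_arrivals A j 0 1 w) #|serve_set X j| = n])).
  apply: fin_bigcup_measurable; first exact: finite_finset.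
  move=> X _; apply: measurableI; first exact: (rounding_measurable rnd X).
  apply: (@measurable_preimage_countable _ _ (num_arrivals A j 0 1) _
    [set m | minn m #|serve_set X j| = n]).
  by move=> m; have [] := poisson_arrivals_law j pA m.
apply/seteqP; split => w /=.
  by rewrite reserve_num_served => h; exists (XR w).
by move=> [X _ [/= <-]]; rewrite reserve_num_served.
Qed.

Let r X := fine (P [set w | XR w = X]).

Lemma sum_rounding_law (f : {ffun U * J -> bool} -> R) : (forall X, 0 <= f X) ->
  ('E_P[fun w => f (XR w)] = (\sum_X f X * r X)%:E)%E.
Proof.
by move=> f0; apply: expectation_finite_range => // X; exact: (rounding_measurable rnd X).
Qed.

(* [min(k, _)] is affine on [[floor y, ceil y]] for integer [k], so rounding
   [y = lp_served x j] does not change the expectation. *)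
Lemma rounding_min j k :
  \sum_X (minn k #|serve_set X j|)%:R * r X = Num.min k%:R (lp_served inst x j).
Proof.
set y := lp_served inst x j.
have sum1 : \sum_X r X = 1.
  apply: EFin_inj; rewrite -[RHS](expectation_cst P 1).
  rewrite (sum_rounding_law (f := fun=> 1)) //.
  by congr (_%:E); apply: eq_bigr => X _; rewrite mul1r.
have sumS : \sum_X #|serve_set X j|%:R * r X = y.
  apply: EFin_inj; rewrite -(rounding_mean rnd j).
  by rewrite (sum_rounding_law (f := fun X => #|serve_set X j|%:R)).
(* The floor-or-ceiling condition constrains only attained values of [XR]; every other [X] has
   weight [r X = 0] and drops out of the sums. *)
have supp X : r X != 0 -> exists w, XR w = X.
  move=> rX; apply: contrapT => h; move/eqP: rX; apply; rewrite /r.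
  have -> : [set w | XR w = X] = set0; last by rewrite measure0.
  by apply/seteqP; split => // w /= wX; apply: h; exists w.
have near_y X : r X != 0 -> Num.floor y <= #|serve_set X j|%:Z <= Num.ceil y.
  move=> /supp[w <-]; have fc : Num.floor y <= Num.ceil y.
    by rewrite -(ler_int R) (le_trans (floor_le_tmp y)) // ceil_ge.
  by case: (rounding_floor_ceil rnd w j) => ->; rewrite lexx ?fc.
have term a X : (r X != 0 -> (minn k #|serve_set X j|)%:R = a) ->
    (minn k #|serve_set X j|)%:R * r X = a * r X.
  by have [->|rX ->//] := eqVneq (r X) 0; rewrite !mulr0.
have [ky|yk] := leP k%:R y.
  transitivity (k%:R * \sum_X r X); last by rewrite sum1 mulr1.
  rewrite mulr_sumr; apply: eq_bigr => X _.
  apply: term => /near_y /andP[fl _]; congr (_%:R); apply/minn_idPl.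
  by rewrite -lez_nat (le_trans _ fl) // floor_ge_int_tmp.
rewrite -[RHS]sumS; apply: eq_bigr => X _; apply: term => /near_y /andP[_ cl].
congr (_%:R); apply/minn_idPr.
by rewrite -lez_nat (le_trans cl) // ceil_le_int_tmp // ltW.
Qed.

Lemma reserve_type_expectation j : lp_served inst x j <= rate inst j ->
  ((lp_served inst x j * (1 - poisson_peak (rate inst j)))%:E
    <= \int[P]_w ((num_served [set j] (A w) (D w))%:R : R)%:E)%E.
Proof.
set y := lp_served inst x j; set lam := rate inst j => ylam.
have lam0 : 0 < lam := rate_gt0 inst j.
pose N := num_arrivals A j 0 1.
have law : poisson_law P lam N := poisson_arrivals_law j pA.
(* [M >= lam] is what [sum_trunc_pmf_min] asks for, and [M >= #|U|] ensures that truncating [N] does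
   not change its minimum with the size of a serve set. *)
pose M := maxn (Num.truncn lam).+1 #|U|.
have lamM : lam <= M%:R.
  by rewrite (le_trans (ltW (truncnS_gt lam))) // ler_nat leq_maxl.
pose Z w : 'I_M.+1 * {ffun U * J -> bool} := (inord (minn (N w) M), XR w).
pose f (z : 'I_M.+1 * {ffun U * J -> bool}) : R :=
  (minn z.1 #|serve_set z.2 j|)%:R.
have ZE z : [set w | Z w = z] =
    [set w | XR w = z.2] `&` [set w | minn (N w) M = z.1].
  apply/seteqP; split => w /= => [<- /=|[]].
    by rewrite inordK // ltnS geq_minr.
  case: z => k X /= <- h; congr (_, _).
  by apply: val_inj; rewrite /= inordK // ltnS geq_minr.
(* Independence is stated for events generated by the arrivals, so the measurability lemmas are
   applied on [T] with that smaller sigma-algebra. *)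
have sig k : <<s arrival_events A>> [set w | minn (N w) M = k].
  pose T' : measurableType _ := g_sigma_algebraType (arrival_events A).
  apply: (@measurable_preimage_countable _ T' N _ [set m | minn m M = k]) => n.
  apply: (@measurable_num_arrivals _ _ _ T' A); last exact: (arrivals_01 pA).
  exact: sub_gen_smallest.
have mNM k : measurable [set w | minn (N w) M = k].
  apply: (@measurable_preimage_countable _ T N _ [set m | minn m M = k]) => n.
  by have [] := law n.
have mZ z : measurable [set w | Z w = z].
  by rewrite ZE; apply: measurableI; [exact: (rounding_measurable rnd)|].
have -> : (\int[P]_w ((num_served [set j] (A w) (D w))%:R : R)%:E
    = 'E_P[fun w => f (Z w)])%E.
  rewrite expectation.unlock; apply: eq_integral => w _; congr (_%:R%:E).
  rewrite reserve_num_served /= inordK ?ltnS ?geq_minr //.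
  rewrite -minnA; congr minn; apply/esym/minn_idPr.
  by rewrite (leq_trans (max_card _)) // leq_maxr.
rewrite expectation_finite_range // lee_fin.
(* Independence factors the joint law; for each fixed [k], [rounding_min] then averages over the
   roundings. *)
have -> : \sum_z f z * fine (P [set w | Z w = z]) =
    \sum_(k < M.+1) Num.min k%:R y * trunc_pmf P N M k.
  transitivity (\sum_k \sum_X f (k, X) * fine (P [set w | Z w = (k, X)])).
    by rewrite pair_bigA /=; apply: eq_bigr => -[].
  apply: eq_bigr => k _; rewrite -rounding_min mulr_suml.
  apply: eq_bigr => X _; rewrite /f /= -mulrA; congr (_ * _).
  rewrite ZE ind // fineM //; apply: fin_num_measure; last exact: mNM.
  exact: rounding_measurable rnd X.
have y0 : 0 <= y.
  rewrite -lee_fin -(rounding_mean rnd j); exact: expectation_ge0.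
have -> : y * (1 - poisson_peak lam) =
    \sum_(k < M.+1) (y / lam) * (Num.min k%:R lam * trunc_pmf P N M k).
  by rewrite -mulr_sumr (sum_trunc_pmf_min lam0 law lamM) mulrA divfK // gt_eqF.
(* Termwise, [(y / lam) * min(k, lam) <= min(k, y)]: the factor [y / lam <= 1] sends [lam] to [y]
   and does not increase [k]. *)
apply: ler_sum => k _; rewrite mulrA ler_wpM2r ?fine_ge0 //.
have yl1 : y / lam <= 1 by rewrite ler_pdivrMr // mul1r.
have yl0 : 0 <= y / lam by rewrite divr_ge0 // ltW.
rewrite le_min; apply/andP; split.
  apply: (@le_trans _ _ (y / lam * k%:R)).
    by rewrite ler_wpM2l // ge_min lexx.
  by rewrite ler_piMl.
apply: (@le_trans _ _ (y / lam * lam)).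
  by rewrite ler_wpM2l // ge_min lexx orbT.
by rewrite divfK // gt_eqF.
Qed.

End ReserveType.

(** Each type keeps at least the fraction [1 - poisson_peak (rate inst j)] of its LP service, and by
    monotonicity of the peak the smallest rate gives the worst fraction. Summing over a group and
    using its LP fairness constraint gives the bound. *)
Lemma reserve_fairness (R : realType) (I J : finType) (inst : instance R I J)
    (lam : R) (d : measure_display) (T : measurableType d) (P : probability T R)
    (A : T -> seq (R * J)) (x : copies inst -> J -> R) (s : R)
    (XR : T -> {ffun copies inst * J -> bool})
    (D : T -> seq (option (copies inst))) :
  0 < lam -> (forall j, lam <= rate inst j) ->
  poisson_arrivals (rate inst) P A -> lp_feasible (unit_copies inst) x s ->
  reserve inst P A x XR D ->
  (((1 - poisson_peak lam) * s)%:E <= fairness inst P A D)%E.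
Proof.
move=> lam0 lamr pA [_ xG xrate s0 x0] [_ rnd ind run].
apply: le_bigmin; first exact: leey.
move=> G Gg; have rG := sum_rate_gt0 Gg.
rewrite inver gt_eqF // lee_pdivlMr // expectation.unlock -EFinM.
under eq_integral do rewrite num_served_sum.
rewrite integral_sum_natr; last first.
  by move=> j; exact: (@measurable_reserve_num_served _ _ _ (unit_copies inst) _ _ P A x XR D).
apply: (@le_trans _ _ (\sum_(j in G) lp_served (unit_copies inst) x j
    * (1 - poisson_peak (rate inst j)))%:E).
  rewrite lee_fin -mulrA.
  apply: le_trans (ler_wpM2l _ (xG G Gg)) _.
    by rewrite subr_ge0 poisson_peak_le1.
  rewrite mulr_sumr; apply: ler_sum => j _; rewrite mulrC ler_wpM2l //.
    by apply: sumr_ge0 => u uj; exact: x0.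
  by rewrite lerB // poisson_peak_anti.
rewrite -sumEFin; apply: lee_sum => j _.
apply: (@reserve_type_expectation _ _ _ (unit_copies inst) _ _ P A x XR) => //.
exact: xrate.
Qed.

Unset Implicit Arguments.

Theorem theorem5 (R : realType) :
  (forall (I J : finType) (inst : instance R I J) (lam : R)
     (d : measure_display) (T : measurableType d) (P : probability T R)
     (A : T -> seq (R * J)) (x : copies inst -> J -> R)
     (XR : T -> {ffun copies inst * J -> bool})
     (D : T -> seq (option (copies inst))),
     is_min_rate inst lam ->
     poisson_arrivals (rate inst) P A ->
     reserve inst P A x XR D ->
     competitive (reserve_bound lam)
       (fairness inst P A D) (clairvoyant_opt inst))
  /\ (forall n : nat, (0 < n)%N ->
        reserve_bound (n%:R : R) =
        (1 - expR (- n%:R) * (n%:R ^+ n / n`!%:R))%:E)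
  /\ reserve_bound lam @[lam --> +oo%R] --> (1%E : \bar R).
Proof.
split; last by split; [exact: reserve_bound_nat | exact: reserve_bound_cvg].
move=> I J inst lam d T P A x XR D [[j rj] lamr] pA res.
have lam0 : 0 < lam by rewrite -rj rate_gt0.
have [s opt] := reserve_lp res.
(* The type [j] that attains the minimal rate is covered by some group. *)
have g0 : groups inst != finset.set0.
  apply/eqP => g0; have := groups_cover inst.
  rewrite g0 /finset.cover big_set0 => /setP/(_ j).
  by rewrite finset.in_set0 finset.in_setT.
rewrite /competitive reserve_boundE //.
apply: le_trans (reserve_fairness lam0 lamr pA opt.1 res).
rewrite EFinM lee_wpmul2l ?lee_fin ?subr_ge0 ?poisson_peak_le1 //.
exact: clairvoyant_opt_le_lp g0 opt.
Qed.
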